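(* For each $r\geq 2$, let $d_{r,r}$ be the smallest nonnegative integer such that whenever $X$ and $Y$ are edge-subgraphs of $K_{r,r}$ with $\delta(X)\geq d_{r,r}$ and $\delta(Y)\geq d_{r,r}$, the friends-and-strangers graph $\mathsf{FS}(X,Y)$ has exactly $2$ connected components. Then for every $r\ge 2$, $$\left\lceil\frac{3r+1}{4}\right\rceil\leq d_{r,r}\leq\left\lceil\frac{3r+2}{4}\right\rceil.$$
   Context: All graphs are simple; $\delta(G)$ denotes the minimum degree of $G$. $K_{r,r}$ is the complete bipartite graph with both partite sets of size $r$; an edge-subgraph of a graph is a subgraph with the same vertex set. For graphs $X$ and $Y$ with $|V(X)|=|V(Y)|$, the friends-and-strangers graph $\mathsf{FS}(X,Y)$ is the graph whose vertices are all bijections $\sigma:V(X)\to V(Y)$, where two bijections $\sigma,\sigma'$ are adjacent if and only if there is an edge $\{a,b\}\in E(X)$ such that $\{\sigma(a),\sigma(b)\}\in E(Y)$, $\sigma(a)=\sigma'(b)$, $\sigma(b)=\sigma'(a)$, and $\sigma(c)=\sigma'(c)$ for all $c\in V(X)\setminus\{a,b\}$. *)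

(* Defs.v *)
From HB Require Import structures.
From mathcomp Require Import all_boot all_order all_algebra all_fingroup.
From mathcomp Require Import boolp.

Set Implicit Arguments.
Unset Strict Implicit.
Unset Printing Implicit Defensive.

Record sgraph (V : finType) := SGraph {
  edge :> rel V;
  edge_sym : symmetric edge;
  edge_irr : irreflexive edge }.

Section Graphs.
Variable V : finType.
Implicit Types (X Y G : sgraph V) (v a b c : V) (s t : {perm V}).

Definition degree G v := #|[set w | G v w]|.

(* The neutral value #|V| exceeds every degree, so for nonempty V this is the
   minimum of the degrees. *)
Definition min_degree G := \big[minn/#|V|]_v degree G v.

(* Both graphs have vertex set V, so a spanning subgraph is a subrelation. *)
Definition edge_subgraph X G := subrel X G.

Definition fs_adj X Y s t :=
  [exists a, exists b,
    [&& X a b, Y (s a) (s b), s a == t b, s b == t a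
      & [forall c in ~: [set a; b], s c == t c]]].

Lemma fs_adj_sym X Y : symmetric (fs_adj X Y).
Proof.
suff imp s t : fs_adj X Y s t -> fs_adj X Y t s.
  by move=> s t; apply/idP/idP; apply: imp.
case/existsP=> a /existsP[b /and5P[Xab Yab /eqP sa /eqP sb /forall_inP eqc]].
apply/existsP; exists a; apply/existsP; exists b.
rewrite Xab -sa -sb edge_sym Yab !eqxx /=.
by apply/forall_inP=> c /eqc; rewrite eq_sym.
Qed.

Lemma fs_adj_irr X Y : irreflexive (fs_adj X Y).
Proof.
move=> s; apply/negbTE/negP.
case/existsP=> a /existsP[b /and5P[_ Yab /eqP sab _ _]].
by rewrite sab edge_irr in Yab.
Qed.

Definition FS X Y : sgraph {perm V} := SGraph (@fs_adj_sym X Y) (@fs_adj_irr X Y).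

Definition num_components G := n_comp (edge G) predT.

End Graphs.

Section CompleteBipartite.
Variable r : nat.

Definition is_left (v : 'I_r + 'I_r) := if v is inl _ then true else false.

Definition Krr_adj (v w : 'I_r + 'I_r) := is_left v != is_left w.

Lemma Krr_adj_sym : symmetric Krr_adj.
Proof. by move=> v w; rewrite /Krr_adj eq_sym. Qed.

Lemma Krr_adj_irr : irreflexive Krr_adj.
Proof. by move=> v; rewrite /Krr_adj eqxx. Qed.

Definition Krr : sgraph ('I_r + 'I_r)%type := SGraph Krr_adj_sym Krr_adj_irr.

Definition forces_two_components (d : nat) : Prop :=
  forall X Y : sgraph ('I_r + 'I_r)%type,
    edge_subgraph X Krr -> edge_subgraph Y Krr ->
    d <= min_degree X -> d <= min_degree Y ->
    num_components (FS X Y) = 2.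

(* A threshold exists: above #|V| the degree hypotheses cannot be met. *)
Lemma forces_two_components_ex : exists d, `[< forces_two_components d >].
Proof.
exists #|{: 'I_r + 'I_r}|.+1; apply/asboolP=> X Y _ _ dX _; exfalso.
have: min_degree X <= #|{: 'I_r + 'I_r}|.
  rewrite /min_degree; elim/big_rec: _ => // v m _ le_m.
  by rewrite geq_min le_m orbT.
by rewrite leqNgt dX.
Qed.

Definition d_rr : nat := ex_minn forces_two_components_ex.

End CompleteBipartite.

(* Main.v *)
Require Import Defs.
From mathcomp Require Import all_boot all_order all_algebra all_fingroup.
From mathcomp Require Import boolp zify.

Set Implicit Arguments.
Unset Strict Implicit.
Unset Printing Implicit Defensive.

(** Read [s : {perm V}] as an arrangement of people on places: [X] joins
    places, [Y] joins acquainted people, and a move swaps two acquainted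
    people standing on joined places, that is, replaces [s] by [tperm a b *
    s].

    Upper bound. Put [m = r - d], so that every vertex misses at most [m]
    vertices of the other side; the hypothesis on [d] says [4 * m + 2 <= r].
    Two connected components come from complete graphs: FS(K, K) with [K] the
    complete bipartite graph has exactly two of them (num_components_Krr),
    separated by the parity [side_parity]. So it suffices that passing from
    [Y] to [K], and then from [X] to [K], does not change the components, and
    for this every two people [u], [v] of opposite sides standing on joined
    places [a], [b] must be exchangeable by a sequence of moves, acquainted or
    not (connect_FS_closure; the second passage is the first one read through
    [s |-> s^-1]).

    To exchange [u] and [v], first rearrange the others without touching [a]
    and [b]; the same moves, run backwards after the exchange, put the others
    back (exchangeable_move). Naming the sides of the people suitably, [u] and
    [v] stand on their own sides. Then the number [q] of left places holding a
    person of the right can be lowered to 0. Indeed, suppose that no single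
    move lowers [q] and look for three moves which together do: two people
    standing on their own sides swap and become misplaced, and then each of
    them swaps with a person who was misplaced before. If this fails for every
    such pair, then the numbers of edges missing between the well placed and
    the misplaced form a fractional vertex cover, scaled by [q], of the graph
    of possible moves among the well placed. That graph has such a large
    minimum degree that the cover must weigh more than the missing edges
    available (unstick, fractional_cover_bound). When [q = 0], two vertices on
    one side have at least [r - 4 * m >= 2] common neighbours in the graph of
    possible moves, which yields five places spanning K_{2,3} in [X] on which
    all cross pairs except possibly [u], [v] are acquainted, and there nine
    explicit moves exchange [u] and [v] (K23_exchangeable).

    Lower bound. If minimum degree [floor (3 * r / 4)] sufficed, one could
    take an arrangement which puts half of the people on the wrong side. Pairs
    which are opposite both as places and as people then form two complete
    bipartite graphs with sides of size about [r / 2], and their edges can be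
    shared evenly between [X] and [Y], while all other edges of [K] are kept.
    The degrees are as required and no move is possible. This isolated vertex
    of FS(X, Y) is a third component, since both classes of [side_parity]
    contain other arrangements. *)

(** * Moves and exchangeability *)

Section Moves.
Variables (V : finType) (X Y : sgraph V).
Implicit Types (a b c d : V) (s t : {perm V}).

Lemma fs_adjP s t :
  reflect (exists a b, [/\ X a b, Y (s a) (s b) & t = (tperm a b * s)%g])
          (fs_adj X Y s t).
Proof.
apply: (iffP existsP) => [[a /existsP[b]]|[a [b [Xab Yab ->]]]].
  case/and5P=> Xab Yab /eqP sa /eqP sb /forall_inP eqc.
  exists a, b; split=> //; apply/permP => z; rewrite permM.
  case: tpermP => [->|->|/eqP za /eqP zb]; rewrite ?sa ?sb //.
  by apply/esym/eqP/eqc; rewrite !inE negb_or za.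
exists a; apply/existsP; exists b; rewrite Xab Yab !permM tpermL tpermR !eqxx /=.
apply/forall_inP => c; rewrite !inE negb_or => /andP[ca cb].
by rewrite permM tpermD // eq_sym.
Qed.

Lemma swap_connect s a b : X a b -> Y (s a) (s b) ->
  connect (FS X Y) s (tperm a b * s)%g.
Proof. by move=> Xab Yab; apply/connect1/fs_adjP; exists a, b. Qed.

Lemma FS_connect_sym : connect_sym (FS X Y).
Proof. by apply: sym_connect_sym => s t; apply: edge_sym. Qed.

Definition exchangeable s a b := connect (FS X Y) s (tperm a b * s)%g.

(** A move that avoids [a] and [b] is available before and after the people on
    [a] and [b] have been exchanged, so it can be undone after the exchange. *)
Lemma exchangeable_move s a b c d :
  c != a -> c != b -> d != a -> d != b -> X c d -> Y (s c) (s d) ->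
  exchangeable (tperm c d * s)%g a b -> exchangeable s a b.
Proof.
move=> ca cb da db Xcd Ycd exc.
apply: connect_trans (swap_connect Xcd Ycd) _; apply: connect_trans exc _.
have comm : (tperm a b * (tperm c d * s) = tperm c d * (tperm a b * s))%g.
  by rewrite !mulgA (conjgC (tperm c d)) tpermJ !tpermD // eq_sym.
rewrite comm FS_connect_sym; apply: swap_connect => //.
by rewrite !permM !tpermD // eq_sym.
Qed.

End Moves.

(** * Exchanging two people on a K_{2,3} of places *)

Section CompleteBipartite23.
Variables (V : finType) (X Y : sgraph V) (s : {perm V}) (a0 a1 b0 b1 b2 : V).
Hypothesis uniq5 : uniq [:: a0; a1; b0; b1; b2].
Hypothesis X_complete : {in [:: a0; a1] & [:: b0; b1; b2], forall a b, X a b}.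

Let neqs :
  (a0 == a1) = false /\ (a0 == b0) = false /\ (a0 == b1) = false /\
  (a0 == b2) = false /\ (a1 == b0) = false /\ (a1 == b1) = false /\
  (a1 == b2) = false /\ (b0 == b1) = false /\ (b0 == b2) = false /\
  (b1 == b2) = false.
Proof.
move: uniq5; rewrite /= !inE !negb_or -!andbA.
case/and5P=> /negbTE-> /negbTE-> /negbTE-> /negbTE-> /and5P[].
move=> /negbTE-> /negbTE-> /negbTE-> /negbTE-> /and3P[].
by move=> /negbTE-> /negbTE-> _.
Qed.

Let reach u0 u1 v0 v1 v2 := exists2 t : {perm V}, connect (FS X Y) s t &
  [/\ t a0 = u0, t a1 = u1, t b0 = v0, t b1 = v1 & t b2 = v2] /\
  {in [predC [:: a0; a1; b0; b1; b2]], t =1 s}.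

(** One move inside the five places, followed on the tuple of their occupants:
    with the places known to be distinct, the new tuple is found by computation. *)
Let reach_swap u0 u1 v0 v1 v2 a b :
  a \in [:: a0; a1] -> b \in [:: b0; b1; b2] ->
  reach u0 u1 v0 v1 v2 ->
  let val c := if c == a0 then u0 else if c == a1 then u1 else
               if c == b0 then v0 else if c == b1 then v1 else v2 in
  let val' c := val (tperm a b c) in
  Y (val a) (val b) -> reach (val' a0) (val' a1) (val' b0) (val' b1) (val' b2).
Proof.
move=> aA bB [t st [[t0 t1 t2 t3 t4] tC]] val val' Yab.
have valE c : c \in [:: a0; a1; b0; b1; b2] -> t c = val c.
  by rewrite /val !inE; do 4![case: eqP => [-> //|_]] => /= /eqP->.
have aW : a \in [:: a0; a1; b0; b1; b2].
  by move: aA; rewrite !inE => /orP[]->; rewrite ?orbT.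
have bW : b \in [:: a0; a1; b0; b1; b2].
  by move: bB; rewrite !inE => /or3P[]->; rewrite ?orbT.
exists (tperm a b * t)%g.
  by apply: connect_trans st _; apply: swap_connect; rewrite ?X_complete ?valE.
have tpW c : c \in [:: a0; a1; b0; b1; b2] ->
    tperm a b c \in [:: a0; a1; b0; b1; b2] by case: tpermP.
split; first by split; rewrite permM valE // tpW // !inE eqxx ?orbT.
move=> c cC; rewrite permM tpermD ?tC //; apply: contraNneq cC => <-.
  exact: aW.
exact: bW.
Qed.

(** On a 4-cycle of places two people who are not acquainted cannot be exchanged;
    a fifth place gives enough room.  Write [u], [x] for the people on
    [a0], [a1] and [v], [y1], [y2] for those on [b0], [b1], [b2].  In the word below
    [v] steps once from [b0] to [a0], at the time when [x] is there to swap with,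
    while [u] travels along [a0], [b1], [a1], [b0], swapping only with [y1] and
    [y2]; the remaining moves make room and bring [x], [y1], [y2] back. *)
Lemma K23_exchangeable :
  {in [:: a0; a1] & [:: b0; b1; b2], forall a b,
     (a, b) != (a0, b0) -> Y (s a) (s b)} ->
  exchangeable X Y s a0 b0.
Proof.
move=> Y_almost; case: neqs => d1 [d2 [d3 [d4 [d5 [d6 [d7 [d8 [d9 d10]]]]]]]].
have dE := (eq_sym a1 a0, eq_sym b0 a0, eq_sym b1 a0, eq_sym b2 a0,
  eq_sym b0 a1, eq_sym b1 a1, eq_sym b2 a1, eq_sym b1 b0, eq_sym b2 b0,
  eq_sym b2 b1, (d1, d2, d3, d4, d5, d6, d7, d8, d9, d10)).
have a0A : a0 \in [:: a0; a1] by rewrite !inE eqxx.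
have a1A : a1 \in [:: a0; a1] by rewrite !inE eqxx orbT.
have b0B : b0 \in [:: b0; b1; b2] by rewrite !inE eqxx.
have b1B : b1 \in [:: b0; b1; b2] by rewrite !inE eqxx orbT.
have b2B : b2 \in [:: b0; b1; b2] by rewrite !inE eqxx !orbT.
have y01 : Y (s a0) (s b1) by rewrite Y_almost // xpair_eqE !dE andbF.
have y02 : Y (s a0) (s b2) by rewrite Y_almost // xpair_eqE !dE andbF.
have y10 : Y (s a1) (s b0) by rewrite Y_almost // xpair_eqE !dE.
have y11 : Y (s a1) (s b1) by rewrite Y_almost // xpair_eqE !dE.
have y12 : Y (s a1) (s b2) by rewrite Y_almost // xpair_eqE !dE.
have R : reach (s a0) (s a1) (s b0) (s b1) (s b2) by exists s.
Ltac swap_at R aA bB dE :=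
  have {}R := reach_swap aA bB R;
  rewrite /= ?permE /= ?dE ?eqxx /= ?dE ?eqxx /= in R;
  have {}R := R ltac:(by rewrite // edge_sym).
swap_at R a0A b1B dE; swap_at R a1A b2B dE; swap_at R a0A b2B dE.
swap_at R a0A b0B dE; swap_at R a1A b0B dE; swap_at R a1A b2B dE.
swap_at R a1A b1B dE; swap_at R a1A b0B dE; swap_at R a1A b2B dE.
case: R => t st [[t0 t1 t2 t3 t4] tC]; rewrite /exchangeable.
suff <- : t = (tperm a0 b0 * s)%g by [].
apply/permP => c; rewrite permM.
case: tpermP => [->|->|/eqP/negbTE ca0 /eqP/negbTE cb0] //.
have [cW|cW] := boolP (c \in [:: a0; a1; b0; b1; b2]); last exact: tC.
by move: cW; rewrite !inE ca0 cb0 /= => /or3P[]/eqP->.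
Qed.

End CompleteBipartite23.

(** * A lower bound for fractional vertex covers *)

Lemma sum_ge_of_neighbour (T : finType) (B N : {set T}) (G : T -> nat) t u :
  N \subset B -> {in B, forall b, t <= G b} -> {in N, forall b, u <= G b} ->
  #|B| * t + #|N| * (u - t) <= \sum_(b in B) G b.
Proof.
move=> /subsetP NB tG uG.
have -> : #|N| * (u - t) = \sum_(b in B) (b \in N) * (u - t).
  rewrite -big_distrl /= -sum1_card; congr (_ * _).
  rewrite [RHS](eq_bigr (fun b => if b \in N then 1 else 0)); last first.
    by move=> b _; case: ifP.
  rewrite -big_mkcondr; apply: eq_bigl => b.
  by apply/idP/andP => [bN|[]//]; split; first exact: NB.
rewrite -sum_nat_const -big_split; apply: leq_sum => b bB.
by have := tG _ bB; have := uG b; case: (b \in N) => [/(_ isT)|_] /=; lia.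
Qed.

(** Linear programming duality between fractional vertex covers and matchings,
    for a bipartite graph [H] with parts of size [p] and minimum degree [D]: such a
    graph has a matching of size [minn p (2 * D)].  A direct argument suffices.
    Let [a] and [b] minimise [F] and [G].  Then [G] is at least [q - F a] on the
    neighbours of [a] and at least [G b] elsewhere, and likewise for [F]. *)
Lemma fractional_cover_bound (T : finType) (A B : {set T}) (H : rel T)
    (F G : T -> nat) (p D q : nat) :
  #|A| = p -> #|B| = p ->
  {in A, forall a, D <= #|[set b in B | H a b]|} ->
  {in B, forall b, D <= #|[set a in A | H a b]|} ->
  {in A & B, forall a b, H a b -> q <= F a + G b} ->
  q * minn p (2 * D) <= \sum_(a in A) F a + \sum_(b in B) G b.
Proof.
move=> cardA cardB degA degB cover.
have [p0|p_gt0] := posnP p; first by rewrite p0 min0n muln0.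
have /card_gt0P[a1 a1A] : 0 < #|A| by rewrite cardA.
have /card_gt0P[b1 b1B] : 0 < #|B| by rewrite cardB.
case: (arg_minnP F a1A) => a aA Fa; case: (arg_minnP G b1B) => b bB Gb.
have sumG := @sum_ge_of_neighbour _ B [set b in B | H a b] G (G b) (q - F a).
have sumF := @sum_ge_of_neighbour _ A [set a in A | H a b] F (F a) (q - G b).
have {}sumG : #|B| * G b + D * (q - F a - G b) <= \sum_(b in B) G b.
  apply: leq_trans (sumG _ _ _).
  - by rewrite leq_add2l leq_mul2r degA ?orbT.
  - by apply/subsetP => c; rewrite inE => /andP[].
  - by move=> c /Gb.
  - by move=> c; rewrite inE => /andP[cB /(cover _ _ aA cB)]; lia.
have {}sumF : #|A| * F a + D * (q - G b - F a) <= \sum_(a in A) F a.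
  apply: leq_trans (sumF _ _ _).
  - by rewrite leq_add2l leq_mul2r degB ?orbT.
  - by apply/subsetP => c; rewrite inE => /andP[].
  - by move=> c /Fa.
  - by move=> c; rewrite inE => /andP[cA /(cover _ _ cA bB)]; lia.
apply: leq_trans (leq_add sumF sumG); rewrite cardA cardB.
have le1 : minn p (2 * D) <= p by rewrite geq_minl.
have le2 : minn p (2 * D) <= 2 * D by rewrite geq_minr.
have [le|gt] := leqP q (F a + G b).
  have -> : q - G b - F a = 0 by lia.
  have -> : q - F a - G b = 0 by lia.
  by nia.
have -> : q - G b - F a = q - (F a + G b) by lia.
have -> : q - F a - G b = q - (F a + G b) by lia.
have -> : p * F a + D * (q - (F a + G b)) + (p * G b + D * (q - (F a + G b))) =
  p * (F a + G b) + 2 * D * (q - (F a + G b)) by nia.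
rewrite -{1}(subnKC (ltnW gt)) mulnDl leq_add // mulnC leq_mul2r ?le1 ?le2 orbT //.
Qed.

(** * Exchangeability under a minimum degree condition *)

(** Places and people have separate bipartitions [lp] and [lq]: people are
    named so that the two to be exchanged stand on their own sides, and this
    may require to interchange the two sides of the people only. *)
Section DenseExchange.
Variables (V : finType) (X Y : sgraph V) (lp lq : pred V) (r m : nat).
Hypothesis card_lp : #|[set c | lp c]| = r.
Hypothesis card_lpC : #|[set c | ~~ lp c]| = r.
Hypothesis card_lq : #|[set c | lq c]| = r.
Hypothesis missX : forall c, #|[set d | (lp d != lp c) && ~~ X c d]| <= m.
Hypothesis missY : forall c, #|[set d | (lq d != lq c) && ~~ Y c d]| <= m.
Hypothesis dense : 4 * m + 2 <= r.
Implicit Types (a b c d : V) (s t : {perm V}) (S : {set V}).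

(** The places on which people stand on their own side (P) or on the wrong side
    (Q), split into left ones (A) and right ones (B).  Every move takes place
    between [PA] and [PB] or between [QA] and [QB]. *)
Let PA s := [set c | lp c && lq (s c)].
Let PB s := [set c | ~~ lp c && ~~ lq (s c)].
Let QA s := [set c | lp c && ~~ lq (s c)].
Let QB s := [set c | ~~ lp c && lq (s c)].

Let card_sides s :
  [/\ #|PA s| + #|QA s| = r, #|PB s| = #|PA s| & #|QB s| = #|QA s|].
Proof.
have cl : #|[set c | lq (s c)]| = r.
  rewrite -card_lq -[RHS](card_preimset _ (@perm_inj _ s)).
  by apply: eq_card => c; rewrite !inE.
have E1 : #|PA s| + #|QA s| = r.
  rewrite -card_lp -(cardsID [set c | lq (s c)] [set c | lp c]); congr (_ + _).
    by apply: eq_card => c; rewrite !inE.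
  by apply: eq_card => c; rewrite !inE andbC.
have E2 : #|PB s| + #|QB s| = r.
  rewrite -card_lpC -(cardsID [set c | lq (s c)] [set c | ~~ lp c]) addnC; congr (_ + _).
    by apply: eq_card => c; rewrite !inE.
  by apply: eq_card => c; rewrite !inE andbC.
have E3 : #|PA s| + #|QB s| = r.
  rewrite -cl -(cardsID [set c | lp c] [set c | lq (s c)]); congr (_ + _).
    by apply: eq_card => c; rewrite !inE andbC.
  by apply: eq_card => c; rewrite !inE.
by split; lia.
Qed.

Let missX_sum c S : {in S, forall d, lp d != lp c} ->
  \sum_(d in S) ~~ X c d <= m.
Proof.
move=> opp; apply: leq_trans (missX c).
rewrite (eq_bigr (fun d => if ~~ X c d then 1 else 0)); last first.
  by move=> d _; case: ifP.
rewrite -big_mkcondr sum1dep_card; apply/subset_leq_card/subsetP => d.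
by rewrite !inE => /andP[/opp-> ->].
Qed.

Let missY_sum s c S : {in S, forall d, lq (s d) != lq (s c)} ->
  \sum_(d in S) ~~ Y (s c) (s d) <= m.
Proof.
move=> opp; apply: leq_trans (missY (s c)).
rewrite (eq_bigr (fun d => if ~~ Y (s c) (s d) then 1 else 0)); last first.
  by move=> d _; case: ifP.
rewrite -big_mkcondr sum1dep_card -(card_imset _ (@perm_inj _ s)).
apply/subset_leq_card/subsetP => _ /imsetP[d + ->].
by rewrite !inE => /andP[/opp-> ->].
Qed.

Let card_QA_out s c d : c \in QA s -> d \in QB s ->
  #|QA (tperm c d * s)%g|.+1 = #|QA s|.
Proof.
move=> cQ dQ; rewrite (cardsD1 c (QA s)) cQ add1n; congr _.+1.
apply: eq_card => z; rewrite !inE permM.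
move: cQ dQ; rewrite !inE => /andP[lc lsc] /andP[ld lsd].
case: tpermP => [->|->|/eqP zc zd]; rewrite ?eqxx ?zc //=.
  by rewrite lsd andbF.
by rewrite (negbTE ld) andbF.
Qed.

Let card_QA_in s c d : c \in PA s -> d \in PB s ->
  #|QA (tperm c d * s)%g| = #|QA s|.+1.
Proof.
move=> cP dP; rewrite (cardsD1 c) inE permM tpermL.
have -> : QA (tperm c d * s)%g :\ c = QA s.
  apply/setP => z; rewrite !inE permM.
  move: cP dP; rewrite !inE => /andP[lc lsc] /andP[ld lsd].
  case: tpermP => [->|->|/eqP zc zd]; rewrite ?eqxx ?zc //=.
    by rewrite lsc andbF.
  by rewrite (negbTE ld) andbF.
by move: cP dP; rewrite !inE => /andP[-> _] /andP[_ ->].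
Qed.

(** If no misplaced pair can swap, some [x], [y] can first swap with each other
    and then with the misplaced [c], [d].  Otherwise every pair [x], [y] that can
    swap has at least [q] missing edges towards [QA] or towards [QB], which makes
    [FA] and [FB] a fractional cover.  Each misplaced vertex has at most [2 * m]
    missing edges in the two graphs together, and at least [q] of them go to
    misplaced vertices, because no misplaced pair can swap.  So the cover weighs
    at most [2 * q * (2 * m - q)], less than the bound of
    [fractional_cover_bound] for [p = r - 1 - q] and [D = p - 2 * m]. *)
Let unstick s a b : a \in PA s -> b \in PB s -> 0 < #|QA s| ->
  {in QA s & QB s, forall c d, X c d -> Y (s c) (s d) -> false} ->
  exists x y c d, [/\ x \in PA s :\ a, y \in PB s :\ b, c \in QA s & d \in QB s] /\
    [/\ X x y && Y (s x) (s y), X c y && Y (s c) (s x) & X x d && Y (s d) (s y)].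
Proof.
move=> aP bP q_gt0 stuck; apply: contrapT => none.
have [cardA cardPB cardQB] := card_sides s.
have {none} blocked x y : x \in PA s :\ a -> y \in PB s :\ b ->
    X x y && Y (s x) (s y) ->
    {in QA s, forall c, 0 < ~~ X c y + ~~ Y (s c) (s x)} \/
    {in QB s, forall d, 0 < ~~ X x d + ~~ Y (s d) (s y)}.
  move=> xP yP xy.
  have [/existsP[c /and3P[cQ Xc Yc]]|/existsPn noc] :=
    boolP [exists c, [&& c \in QA s, X c y & Y (s c) (s x)]].
    right=> d dQ; rewrite lt0n addn_eq0 !eqb0 !negbK; apply/negP => xd.
    by apply: none; exists x, y, c, d; rewrite xd xy Xc Yc.
  left=> c cQ; rewrite lt0n addn_eq0 !eqb0 !negbK; apply/negP => /andP[Xc Yc].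
  by have := noc c; rewrite cQ Xc Yc.
set q := #|QA s| in cardA cardQB q_gt0.
pose FA x := \sum_(d in QB s) ~~ X x d + \sum_(c in QA s) ~~ Y (s c) (s x).
pose FB y := \sum_(c in QA s) ~~ X c y + \sum_(d in QB s) ~~ Y (s d) (s y).
pose H := [rel x y | X x y && Y (s x) (s y)].
pose p := #|PA s|.-1.
have cardPAa : #|PA s :\ a| = p by rewrite /p (cardsD1 a (PA s)) aP.
have cardPBb : #|PB s :\ b| = p by rewrite /p -cardPB (cardsD1 b (PB s)) bP.
have cover : {in PA s :\ a & PB s :\ b, forall x y, H x y -> q <= FA x + FB y}.
  move=> x y xP yP /(blocked x y xP yP) [] block.
    apply: (@leq_trans (\sum_(c in QA s) (~~ X c y + ~~ Y (s c) (s x)))).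
      by rewrite /q -sum1_card leq_sum.
    by rewrite big_split /FA /FB /=; lia.
  apply: (@leq_trans (\sum_(d in QB s) (~~ X x d + ~~ Y (s d) (s y)))).
    by rewrite -cardQB -sum1_card leq_sum.
  by rewrite big_split /FA /FB /=; lia.
have degree_bound (S : {set V}) x (T := [set y in S | H x y]) :
    {in S, forall y, lp y != lp x} -> {in S, forall y, lq (s y) != lq (s x)} ->
    #|S| <= #|T| + 2 * m.
  move=> oppX oppY; rewrite -(cardsID [set y | H x y] S).
  have -> : S :&: [set y | H x y] = T by apply/setP => y; rewrite !inE.
  rewrite leq_add2l -sum1_card.
  apply: (@leq_trans (\sum_(y in S) (~~ X x y + ~~ Y (s x) (s y)))).
    rewrite [X in _ <= X](big_setID [set y | H x y]) /=.
    apply: leq_trans (leq_addl _ _); apply: leq_sum => y.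
    by rewrite !inE negb_and => /andP[]; case: (X x y); case: (Y _ _).
  by rewrite big_split mul2n -addnn leq_add // ?missX_sum ?missY_sum.
have degA : {in PA s :\ a, forall x, p - 2 * m <= #|[set y in PB s :\ b | H x y]|}.
  move=> x; rewrite !inE => /and3P[_ lx lsx].
  rewrite leq_subLR addnC -{1}cardPBb; apply: degree_bound => y.
    by rewrite !inE lx => /and3P[_ /negbTE-> _].
  by rewrite !inE lsx => /and3P[_ _ /negbTE->].
have degB : {in PB s :\ b, forall y, p - 2 * m <= #|[set x in PA s :\ a | H x y]|}.
  move=> y; rewrite !inE => /and3P[_ /negbTE ly /negbTE lsy].
  have -> : [set x in PA s :\ a | H x y] = [set x in PA s :\ a | H y x].
    by apply/setP => x; rewrite !inE /= edge_sym (edge_sym Y).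
  rewrite leq_subLR addnC -{1}cardPAa; apply: degree_bound => x.
    by rewrite !inE ly => /and3P[_ -> _].
  by rewrite !inE lsy => /and3P[_ _ ->].
have lower := fractional_cover_bound cardPAa cardPBb degA degB cover.
have row_bound (c : V) (S T Q : {set V}) :
    {in S :|: Q, forall d, lp d != lp c} -> [disjoint S & Q] ->
    {in T :|: Q, forall d, lq (s d) != lq (s c)} -> [disjoint T & Q] ->
    {in Q, forall d, X c d -> Y (s c) (s d) -> false} ->
    \sum_(d in S) ~~ X c d + \sum_(d in T) ~~ Y (s c) (s d) + #|Q| <= 2 * m.
  move=> /missX_sum sX SQ /missY_sum sY TQ noQ.
  have sumU (F : V -> nat) (U : {set V}) : [disjoint U & Q] ->
      \sum_(d in U :|: Q) F d = \sum_(d in U) F d + \sum_(d in Q) F d.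
    by move=> UQ; rewrite -bigU //; apply: eq_bigl => d; rewrite !inE.
  rewrite sumU // in sX; rewrite sumU // in sY.
  suff : #|Q| <= \sum_(d in Q) ~~ X c d + \sum_(d in Q) ~~ Y (s c) (s d) by lia.
  rewrite -big_split -sum1_card /=; apply: leq_sum => d /noQ.
  by case: (X c d) => //; case: (Y _ _) => // /(_ isT isT).
have rowQA : \sum_(c in QA s) (\sum_(y in PB s :\ b) ~~ X c y +
    \sum_(x in PA s :\ a) ~~ Y (s c) (s x) + q) <= q * (2 * m).
  rewrite -sum_nat_const; apply: leq_sum => c cQ; rewrite -cardQB.
  move: (cQ); rewrite inE => /andP[lc /negbTE lsc]; apply: row_bound.
  - by move=> d; rewrite !inE lc => /orP[/and3P[_ /negbTE->]|/andP[/negbTE->]].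
  - rewrite -setI_eq0; apply/eqP/setP => d; rewrite !inE.
    by case: (lq (s d)); rewrite ?andbF.
  - by move=> d; rewrite !inE lsc => /orP[/and3P[_ _ ->]|/andP[_ ->]].
  - rewrite -setI_eq0; apply/eqP/setP => d; rewrite !inE.
    by case: (lp d); rewrite ?andbF.
  - by move=> d dQ Xcd Ycd; apply: (stuck c d).
have rowQB : \sum_(d in QB s) (\sum_(x in PA s :\ a) ~~ X d x +
    \sum_(y in PB s :\ b) ~~ Y (s d) (s y) + q) <= q * (2 * m).
  rewrite -cardQB -sum_nat_const; apply: leq_sum => d dQ; rewrite cardQB.
  move: (dQ); rewrite inE => /andP[/negbTE ld lsd]; apply: row_bound.
  - by move=> c; rewrite !inE ld => /orP[/and3P[_ ->]|/andP[->]].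
  - rewrite -setI_eq0; apply/eqP/setP => c; rewrite !inE.
    by case: (lq (s c)); rewrite ?andbF.
  - by move=> c; rewrite !inE lsd => /orP[/and3P[_ _ /negbTE->]|/andP[_ /negbTE->]].
  - rewrite -setI_eq0; apply/eqP/setP => c; rewrite !inE.
    by case: (lp c); rewrite ?andbF.
  - by move=> c cQ; rewrite edge_sym (edge_sym Y); apply: (stuck c d).
have double_count : \sum_(x in PA s :\ a) FA x + \sum_(y in PB s :\ b) FB y
    + 2 * q * q <= 2 * q * (2 * m).
  apply: leq_trans (_ : q * (2 * m) + q * (2 * m) <= _); last by lia.
  apply: leq_trans (leq_add rowQA rowQB).
  rewrite !big_split /= !sum_nat_const -/q cardQB.
  have swap (S T : {set V}) (F : V -> V -> nat) :
      \sum_(x in S) \sum_(y in T) F x y = \sum_(y in T) \sum_(x in S) F x y.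
    exact: exchange_big.
  rewrite (swap (QA s) (PB s :\ b)) (swap (QA s) (PA s :\ a)).
  rewrite (swap (QB s) (PB s :\ b)) (swap (QB s) (PA s :\ a)).
  rewrite (eq_bigr (fun x => \sum_(d in QB s) nat_of_bool (~~ X d x))); last first.
    by move=> x _; apply: eq_bigr => d _; rewrite edge_sym.
  lia.
have : minn p (2 * (p - 2 * m)) + 2 * q <= 4 * m.
  rewrite -(leq_pmul2l q_gt0) mulnDr; apply: leq_trans (leq_add lower (leqnn _)) _.
  by move: double_count; lia.
have PA_gt0 : 0 < #|PA s| by rewrite (cardsD1 a) aP.
by move: cardA dense q_gt0 PA_gt0; rewrite /p; lia.
Qed.

(** With nobody misplaced, [b] has a neighbour [a1] in the graph of possible
    moves, and [a], [a1] have two common neighbours there besides [b].  There are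
    [r - 1] candidates, and [a], [a1] together miss at most [4 * m] vertices, one
    of which is [b] itself. *)
Lemma exchangeable_sorted s a b : lp a -> ~~ lp b -> QA s = set0 ->
  X a b -> exchangeable X Y s a b.
Proof.
move=> la lb q0 Xab.
have [Yab|Yab] := boolP (Y (s a) (s b)); first exact: swap_connect.
have [_ _] := card_sides s; rewrite q0 cards0 => /eqP; rewrite cards_eq0 => /eqP qB0.
have lqA c : lp c -> lq (s c).
  move=> lc; apply: contraT => lsc.
  by have := in_set0 c; rewrite -q0 inE lc lsc.
have lqB c : ~~ lp c -> ~~ lq (s c).
  move=> lc; apply/negP => lsc.
  by have := in_set0 c; rewrite -qB0 inE lc lsc.
pose mis c d := ~~ X c d + ~~ Y (s c) (s d).
have mis_sum c : \sum_(d in [set d | lp d != lp c]) mis c d <= 2 * m.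
  rewrite big_split mul2n -addnn leq_add // ?missX_sum ?missY_sum // => d;
    rewrite !inE //.
  have [/lqA ldE|/[dup] ld /lqB ldE] := boolP (lp d);
  have [/lqA lcE|/[dup] lc /lqB lcE] := boolP (lp c);
  by rewrite ?(negbTE ldE) ?(negbTE lcE) ?ldE ?lcE.
have misE c d : mis c d = 0 -> X c d && Y (s c) (s d).
  by rewrite /mis; case: (X c d); case: (Y _ _).
have [a1 a1A /misE/andP[Xa1b Ya1b]] : exists2 a1, lp a1 & mis b a1 = 0.
  apply: contrapT => no.
  have: r <= 2 * m; last by lia.
  apply: leq_trans (mis_sum b); rewrite -card_lp -sum1_card.
  under eq_bigl => c do rewrite inE.
  under [X in _ <= X]eq_bigl => c do rewrite inE (negbTE lb) eqbF_neg negbK.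
  apply: leq_sum => c lc; rewrite lt0n; apply/eqP => mis0.
  by apply: no; exists c.
pose good := [set d | ~~ lp d && (d != b) && (mis a d + mis a1 d == 0)].
have good_gt1 : 1 < #|good|.
  pose B := [set d | ~~ lp d]; pose w d := mis a d + mis a1 d.
  have sumw : \sum_(d in B) w d <= 4 * m.
    have -> : 4 * m = 2 * m + 2 * m by lia.
    rewrite big_split; apply: leq_add; [move: (mis_sum a)|move: (mis_sum a1)];
      apply: leq_trans; apply/eq_leq/eq_bigl => d; rewrite !inE.
      by rewrite la eqb_id.
    by rewrite a1A eqb_id.
  have wb : 0 < w b by rewrite /w /mis Yab addn1.
  have bB : b \in B by rewrite inE.
  have : #|B :\ b| <= #|good| + \sum_(d in B :\ b) w d.
    have -> : #|good| = \sum_(d in B :\ b) (w d == 0).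
      rewrite -sum1_card [RHS](eq_bigr (fun d => if w d == 0 then 1 else 0)).
        by rewrite -big_mkcondr; apply: eq_bigl => d; rewrite !inE (andbC (d != b)).
      by move=> d _; case: eqP.
    rewrite -big_split -sum1_card; apply: leq_sum => d _.
    by case: (w d).
  have := cardsD1 b B; rewrite bB card_lpC.
  by move: sumw; rewrite (big_setD1 b) //=; lia.
have [b1 b1G] : exists b1, b1 \in good by apply/card_gt0P; apply: ltnW.
have [b2] : exists b2, b2 \in good :\ b1.
  by apply/card_gt0P; move: good_gt1; rewrite (cardsD1 b1) b1G.
rewrite inE in_set1; move: b1G; rewrite !inE addn_eq0.
case/andP=> /andP[lb1 b1b] /andP[/eqP/misE/andP[X01 Y01] /eqP/misE/andP[X11 Y11]].
case/andP=> b21; rewrite addn_eq0.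
case/andP=> /andP[lb2 b2b] /andP[/eqP/misE/andP[X02 Y02] /eqP/misE/andP[X12 Y12]].
have neq c d : lp c -> ~~ lp d -> c != d by move=> lc; apply: contraNneq => <-.
have a01 : a != a1 by apply: contraNneq Yab => ->; rewrite edge_sym.
apply: (@K23_exchangeable _ X Y s a a1 b b1 b2).
- rewrite /= !inE !negb_or a01 (neq a b) // (neq a b1) // (neq a b2) //.
  rewrite (neq a1 b) // (neq a1 b1) // (neq a1 b2) //.
  by rewrite (eq_sym b b1) (eq_sym b b2) (eq_sym b1 b2) b1b b2b b21.
- move=> c d; rewrite !inE => /orP[]/eqP-> /or3P[]/eqP-> //.
  by rewrite edge_sym.
- move=> c d; rewrite !inE => /orP[]/eqP-> /or3P[]/eqP-> //; first by rewrite eqxx.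
  by rewrite edge_sym.
Qed.

(** Induction on the number of misplaced people, none of whom stands on [a] or
    [b]: either one move decreases it, or it is increased once and then
    decreased twice. *)
Lemma exchangeable_of_dense s a b :
  lp a -> ~~ lp b -> lq (s a) -> ~~ lq (s b) -> X a b -> exchangeable X Y s a b.
Proof.
move=> la lb + + Xab.
have [n] := ubnP #|QA s|; elim: n => // n IH in s *; rewrite ltnS => q_le lsa lsb.
have [/eqP q0|q_gt0] := posnP #|QA s|.
  by apply: exchangeable_sorted => //; apply/eqP; rewrite -cards_eq0.
have aP : a \in PA s by rewrite inE la.
have bP : b \in PB s by rewrite inE lb.
have aQ s' d : lq (s' a) -> d \in QA s' -> d != a.
  by move=> ls; rewrite inE => /andP[_]; apply: contraNneq => ->.
have bQ s' d : ~~ lq (s' b) -> d \in QB s' -> d != b.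
  by move=> ls; rewrite inE => /andP[_]; apply: contraTneq => ->.
have lpN c d : lp c -> ~~ lp d -> c != d by move=> lc; apply: contraNneq => <-.
have [/existsP[c /existsP[d /and4P[cQ dQ Xcd Ycd]]]|none] :=
  boolP [exists c, exists d, [&& c \in QA s, d \in QB s, X c d & Y (s c) (s d)]].
  have qE := card_QA_out cQ dQ.
  have ca := aQ _ _ lsa cQ; have db := bQ _ _ lsb dQ.
  have cb : c != b by apply: lpN lb; move: cQ; rewrite inE => /andP[].
  have da : d != a by rewrite eq_sym lpN //; move: dQ; rewrite inE => /andP[].
  apply: (exchangeable_move ca cb da db Xcd Ycd).
  apply: IH; first by rewrite -qE in q_le.
    by rewrite permM tpermD.
  by rewrite permM tpermD.
have stuck : {in QA s & QB s, forall c d, X c d -> Y (s c) (s d) -> false}.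
  move=> c d cQ dQ Xcd Ycd; apply: contraNT none => _.
  by apply/existsP; exists c; apply/existsP; exists d; rewrite cQ dQ Xcd.
have [x [y [c [d [[xP yP cQ dQ] []]]]]] := unstick aP bP q_gt0 stuck.
case/andP=> Xxy Yxy /andP[Xcy Ycx] /andP[Xxd Ydy].
have q1 : #|QA (tperm x y * s)%g| = #|QA s|.+1.
  by apply: card_QA_in; [case/setD1P: xP|case/setD1P: yP].
move: xP yP cQ dQ; rewrite !inE.
case/and3P=> xa lx lsx /and3P[yb ly lsy] /andP[lc lsc] /andP[ld lsd].
have xb := lpN x b lx lb; have cb := lpN c b lc lb.
have ya : y != a by rewrite eq_sym lpN.
have da : d != a by rewrite eq_sym lpN.
have ca : c != a by apply: contraNneq lsc => ->.
have db : d != b by apply: contraNneq lsb => <-.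
have xc : x != c by apply: contraNneq lsc => <-.
have yd : y != d by apply: contraNneq lsy => ->.
have xy := lpN x y lx ly; have xd := lpN x d lx ld.
have cy := lpN c y lc ly; have cd := lpN c d lc ld.
have q2 : #|QA (tperm c y * (tperm x y * s))%g|.+1 = #|QA s|.+1.
  rewrite -q1 card_QA_out // inE ?permM ?tpermR ?ly //.
  by rewrite tpermD // ?lc // eq_sym.
have q3 : #|QA (tperm x d * (tperm c y * (tperm x y * s)))%g|.+1 = #|QA s|.
  apply: succn_inj; rewrite -q2 card_QA_out // inE ?permM ?ld ?lx.
    by rewrite (tpermD (z := x)) // ?tpermL // eq_sym.
  by rewrite (tpermD (z := d)) // tpermD.
apply: (@exchangeable_move _ X Y s a b x y) => //.
apply: (@exchangeable_move _ X Y _ a b c y) => //.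
  by rewrite !permM tpermR tpermD // eq_sym.
apply: (@exchangeable_move _ X Y _ a b x d) => //.
  rewrite !permM (tpermD (z := x)) ?tpermL; last 2 first.
  - by rewrite eq_sym.
  - by rewrite eq_sym.
  by rewrite (tpermD (z := d)) // (tpermD (z := d)) // edge_sym.
apply: IH; first by rewrite -q3 in q_le.
  by rewrite !permM !tpermD.
by rewrite !permM !tpermD.
Qed.

End DenseExchange.

(** * Counting connected components *)

Lemma n_comp_roots (T : finType) (e : rel T) :
  connect_sym e -> n_comp e predT = #|[set fingraph.root e x | x : T]|.
Proof.
move=> sym_e; rewrite /n_comp_mem; apply: eq_card => x; rewrite !inE andbT.
apply/idP/imsetP => [/eqP xr|[y _ ->]]; first by exists x.
exact: fingraph.roots_root.
Qed.

Lemma n_comp_eq2 (T : finType) (e : rel T) x y : connect_sym e ->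
  ~~ connect e x y -> (forall z, connect e z x || connect e z y) ->
  n_comp e predT = 2.
Proof.
move=> sym_e; rewrite -(root_connect sym_e) n_comp_roots // => xy cover.
have -> : [set fingraph.root e z | z : T] = [set fingraph.root e x; fingraph.root e y].
  apply/eqP; rewrite eqEsubset; apply/andP; split; apply/subsetP => z.
    case/imsetP => w _ ->; rewrite !inE.
    by have := cover w; rewrite -!(root_connect sym_e).
  by case/set2P => ->; apply: imset_f.
by rewrite cards2 xy.
Qed.

Lemma n_comp_gt2 (T : finType) (e : rel T) x y z : connect_sym e ->
  ~~ connect e x y -> ~~ connect e x z -> ~~ connect e y z ->
  2 < n_comp e predT.
Proof.
move=> sym_e; rewrite -!(root_connect sym_e) n_comp_roots // => xy xz yz.
pose rt := fingraph.root e.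
apply: leq_trans (_ : #|[set rt x; rt y; rt z]| <= _).
  by rewrite setUC cardsU1 !inE negb_or cards2 xy !(eq_sym (rt z)) xz yz.
apply/subset_leq_card/subsetP => w.
by rewrite !inE => /orP[/orP[]|] /eqP->; apply: imset_f.
Qed.

(** * Enlarging one of the two graphs *)

Section Connectivity.
Variables (V : finType) (X Y K : sgraph V).
Implicit Types s t : {perm V}.

(** Inversion exchanges the roles of places and people: the swap of the people on
    [a] and [b] becomes the swap of the places of [s a] and [s b]. *)
Lemma connect_FS_inv s t :
  connect (FS X Y) s t -> connect (FS Y X) s^-1%g t^-1%g.
Proof.
case/connectP=> p; elim: p s => [|u p IH] s /= => [_ ->//|/andP[su pu] tE].
apply: connect_trans (IH _ pu tE); case/fs_adjP: su => a [b [Xab Yab ->]].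
have -> : ((tperm a b * s)^-1 = tperm (s a) (s b) * s^-1)%g.
  by rewrite -tpermJ invMg tpermV conjgE !mulgA mulgK.
by apply: swap_connect; rewrite ?permK.
Qed.

Lemma connect_FS_closure : edge_subgraph Y K ->
  (forall s a b, X a b -> K (s a) (s b) -> exchangeable X Y s a b) ->
  connect (FS X Y) =2 connect (FS X K).
Proof.
move=> YK exch s t; apply/idP/idP; apply: connect_sub => {s t} s t /fs_adjP.
  by case=> a [b [Xab /YK Kab ->]]; apply: swap_connect.
by case=> a [b [Xab Kab ->]]; apply: exch.
Qed.

End Connectivity.

(** * The complete bipartite case *)

Section TwoComponents.
Variable r : nat.
Notation V := ('I_r + 'I_r)%type.
Notation left := (@Defs.is_left r).
Implicit Types (a b c d x y : V) (s t : {perm V}).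

(** The second summand is the parity of the number of left people standing on
    left places; a move changes both summands. *)
Definition side_parity s : bool :=
  odd_perm s (+) \big[addb/false]_(c | left c) left (s c).

Lemma side_parity_same_side c d s : c != d -> left c = left d ->
  side_parity (tperm c d * s)%g = ~~ side_parity s.
Proof.
move=> cd lcd; rewrite /side_parity odd_mul_tperm cd addTb addNb.
rewrite (reindex_inj (@perm_inj _ (tperm c d))).
congr (~~ (_ (+) _)); apply: eq_big => [z|z _]; last by rewrite permM tpermK.
by case: tpermP => // ->.
Qed.

Lemma side_parity_move a b s : Krr r a b -> Krr r (s a) (s b) ->
  side_parity (tperm a b * s)%g = side_parity s.
Proof.
wlog la : a b / left a => [WL|].
  case la: (left a); first exact: WL.
  rewrite tpermC edge_sym [Krr _ (s a) _]edge_sym => Kba Ksba.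
  by apply: (WL b a) => //; move: Kba; rewrite /= /Krr_adj la; case: (left b).
rewrite /= /Krr_adj la /= => lb lsab; rewrite /side_parity odd_mul_tperm.
have -> : a != b by apply: contraNneq lb => <-; rewrite la.
rewrite (bigD1 a) //= [in RHS](bigD1 a) //= permM tpermL.
have -> : left (s b) = ~~ left (s a) by case: (left (s a)) lsab; case: (left _).
rewrite (eq_bigr (fun c => left (s c))); last first.
  move=> c /andP[lc ca]; have cb : c != b.
    by apply: contraNneq lb => <-; rewrite lc.
  by rewrite permM tpermD // eq_sym.
by rewrite !addbA; congr (_ (+) _); case: (odd_perm s); case: (left (s a)).
Qed.

Lemma side_parity_connect s t :
  connect (FS (Krr r) (Krr r)) s t -> side_parity s = side_parity t.
Proof.
case/connectP=> p; elim: p s => [|u p IH] s /= => [_ ->//|/andP[su pu] tE].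
rewrite -(IH _ pu tE); case/fs_adjP: su => a [b [Kab Ksab ->]].
by rewrite side_parity_move.
Qed.

Let preserves_sides s := forall c, left (s c) = left c.

Let KK := FS (Krr r) (Krr r).
Let KKsym : connect_sym KK := @FS_connect_sym _ _ _.

Lemma invariant_preim s (A : {set V}) :
  {in A, forall c, s c \in A} -> forall c, (s c \in A) = (c \in A).
Proof.
move=> sA c; have /setP/(_ c) : A = s @^-1: A; last by rewrite inE.
apply/eqP; rewrite eqEcard card_preimset ?leqnn ?andbT; last exact: perm_inj.
by apply/subsetP => x /sA; rewrite inE.
Qed.

(** As long as a left place holds a right person, some right place holds a left
    person, and these two can swap. *)
Lemma connect_preserves_sides s :
  exists2 t, preserves_sides t & connect KK s t.
Proof.
have [n] := ubnP #|[set c | left c && ~~ left (s c)]|.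
elim: n => // n IH in s *; rewrite ltnS => le_n.
have [q0|[c]] := set_0Vmem [set c | left c && ~~ left (s c)].
  exists s => // c.
  have sL : {in [set d | left d], forall d, s d \in [set d | left d]}.
    move=> d; rewrite !inE => ld; apply: contraT => lsd.
    by have := in_set0 d; rewrite -q0 inE ld lsd.
  by have := invariant_preim sL c; rewrite !inE.
rewrite inE => /andP[lc lsc].
have [d ld lsd] : exists2 d, ~~ left d & left (s d).
  have [/existsP[d /andP[ld lsd]]|/existsPn no] :=
    boolP [exists d, ~~ left d && left (s d)]; first by exists d.
  have sR : {in [set d | ~~ left d], forall d, s d \in [set d | ~~ left d]}.
    by move=> d; rewrite !inE => ld; have := no d; rewrite ld.
  by have := invariant_preim sR c; rewrite !inE lsc lc.
have cd : c != d by apply: contraNneq ld => <-.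
have [|t pt st] := IH (tperm c d * s)%g.
- apply: leq_trans le_n; apply/proper_card/properP; split.
    apply/subsetP => z; rewrite !inE permM => /andP[lz]; rewrite lz /=.
    by case: tpermP => [->|zd|//]; [rewrite lsc | rewrite -zd lz in ld].
  by exists c; rewrite !inE ?lc // permM tpermL lsd.
exists t => //; apply: connect_trans st.
by apply: swap_connect; rewrite /= /Krr_adj ?lc ?lsd ?(negbTE ld) ?(negbTE lsc).
Qed.

(** Four moves around the 4-cycle [c], [d], [c'], [d'] carry out both
    transpositions, so each of them undoes the other up to connectedness. *)
Lemma connect_tperm_opposite s c c' d d' : preserves_sides s ->
  left c -> left c' -> c != c' -> ~~ left d -> ~~ left d' -> d != d' ->
  connect KK (tperm c c' * s)%g (tperm d d' * s)%g.
Proof.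
move=> ps lc lc' cc' ld ld' dd'.
have neq x y : left x -> ~~ left y -> x != y.
  by move=> lx; apply: contraNneq => <-.
have [cd cd' c'd c'd'] := And4 (neq _ _ lc ld) (neq _ _ lc ld')
  (neq _ _ lc' ld) (neq _ _ lc' ld').
have dE := (negbTE cc', negbTE dd', negbTE cd, negbTE cd', negbTE c'd,
  negbTE c'd', eqxx).
have dE' := (eq_sym c' c, eq_sym d' d, eq_sym d c, eq_sym d' c, eq_sym d c',
  eq_sym d' c', dE).
have step t x y : left x -> ~~ left y -> left (t x) -> ~~ left (t y) ->
    connect KK t (tperm x y * t)%g.
  move=> lx ly ltx lty; apply: swap_connect.
    by rewrite /= /Krr_adj lx (negbTE ly).
  by rewrite /= /Krr_adj ltx (negbTE lty).
have step' t x y : left x -> ~~ left y -> ~~ left (t x) -> left (t y) ->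
    connect KK t (tperm x y * t)%g.
  move=> lx ly ltx lty; apply: swap_connect.
    by rewrite /= /Krr_adj lx (negbTE ly).
  by rewrite /= /Krr_adj lty (negbTE ltx).
pose t0 := (tperm c c' * s)%g; pose t1 := (tperm c d' * t0)%g.
pose t2 := (tperm c' d * t1)%g; pose t3 := (tperm c d * t2)%g.
have -> : (tperm d d' * s)%g = (tperm c' d' * t3)%g.
  apply/permP => z; rewrite !permM !permE /=.
  have [->|zc] := eqVneq z c; first by do 5?[rewrite ?dE' /=].
  have [->|zc'] := eqVneq z c'; first by do 5?[rewrite ?dE' /=].
  have [->|zd] := eqVneq z d; first by do 5?[rewrite ?dE' /=].
  by have [zE|zd'] := eqVneq z d'; rewrite ?zE; do 5?[rewrite ?dE' /=];
    rewrite ?(negbTE zc, negbTE zc', negbTE zd, negbTE zd').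
have t0c : t0 c = s c' by rewrite permM tpermL.
have t0d' : t0 d' = s d' by rewrite permM tpermD // ?dE'.
have t1c' : t1 c' = s c by rewrite permM tpermD ?dE' // permM tpermR.
have t1d : t1 d = s d.
  by rewrite permM tpermD ?dE' // permM tpermD ?dE'.
have t2c : t2 c = s d' by rewrite permM tpermD ?dE' // permM tpermL.
have t2d : t2 d = s c by rewrite permM tpermR.
have t3c' : t3 c' = s d by rewrite permM tpermD ?dE' // permM tpermL.
have t3d' : t3 d' = s c'.
  by rewrite permM tpermD ?dE' // permM tpermD ?dE' // permM tpermR.
apply: connect_trans (_ : connect KK t0 t1) _.
  by apply: step; rewrite // ?t0c ?t0d' ps.
apply: connect_trans (_ : connect KK t1 t2) _.
  by apply: step; rewrite // ?t1c' ?t1d ps.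
apply: connect_trans (_ : connect KK t2 t3) _.
  by apply: step'; rewrite // ?t2c ?t2d ps.
by apply: step'; rewrite // ?t3c' ?t3d' ps.
Qed.

(** All transpositions inside a side lead to the same component: two on opposite
    sides by the previous lemma, two on the same side through one on the other
    side. *)
Lemma connect_tperm_same_side s a a' b b' x y : preserves_sides s ->
  left a -> left a' -> a != a' -> ~~ left b -> ~~ left b' -> b != b' ->
  left x = left y -> x != y ->
  connect KK (tperm x y * s)%g (tperm a a' * s)%g.
Proof.
move=> ps la la' aa' lb lb' bb' lxy xy.
case lx: (left x); last first.
  by rewrite KKsym connect_tperm_opposite // -?lxy lx.
apply: connect_trans (_ : connect KK _ (tperm b b' * s)%g) _.
  by rewrite connect_tperm_opposite // -lxy.
by rewrite KKsym connect_tperm_opposite.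
Qed.

Lemma num_components_Krr : 2 <= r -> num_components KK = 2.
Proof.
move=> r2; have r0 : 0 < r by apply: ltnW.
pose a : V := inl (Ordinal r0); pose a' : V := inl (Ordinal r2).
pose b : V := inr (Ordinal r0); pose b' : V := inr (Ordinal r2).
pose k := tperm a a'.
have same s x y : preserves_sides s -> left x = left y -> x != y ->
    connect KK (tperm x y * s)%g (k * s)%g.
  by move=> ps; apply: (@connect_tperm_same_side s a a' b b' x y ps).
apply: (@n_comp_eq2 _ _ 1%g k) => //.
  apply/negP => /side_parity_connect; rewrite -[k]mulg1 side_parity_same_side //.
  by case: side_parity.
(* Stated for the pair of [s] and [k * s], so that the induction survives a
   transposition, which exchanges the components of these two. *)
have sorted s : preserves_sides s ->
   connect KK s 1%g && connect KK (k * s)%g k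
   || connect KK s k && connect KK (k * s)%g 1%g.
  have [n] := ubnP #|[set c | s c != c]|; elim: n => // n IH in s *.
  rewrite ltnS => le_n ps.
  have [fix0|[x]] := set_0Vmem [set c | s c != c].
    have -> : s = 1%g.
      apply/permP => x; rewrite perm1; apply/eqP; apply: contraT => sx.
      by have := in_set0 x; rewrite -fix0 inE sx.
    by rewrite mulg1 !connect0.
  rewrite inE => sx; pose y := s^-1%g x.
  have sy : s y = x by rewrite permKV.
  have xy : x != y by apply: contraNneq sx => {1}->; rewrite sy.
  have lxy : left x = left y by rewrite -sy ps.
  pose s' := (tperm x y * s)%g.
  have ps' : preserves_sides s'.
    by move=> z; rewrite permM ps; case: tpermP => // ->.
  have sE : s = (tperm x y * s')%g by rewrite mulgA tperm2 mul1g.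
  have lt_n : #|[set c | s' c != c]| < n.
    apply: leq_trans le_n; apply/proper_card/properP; split.
      apply/subsetP => z; rewrite !inE permM.
      by case: tpermP => [-> _|-> _|//]; rewrite ?sy.
    by exists x; rewrite !inE // permM tpermL sy eqxx.
  have s_ks' := same s' x y ps' lxy xy; have s'_ks := same s x y ps lxy xy.
  rewrite -sE in s_ks'; rewrite KKsym in s'_ks.
  by case/orP: (IH s' lt_n ps') => /andP[s'1 ks'k]; apply/orP; [right|left];
    rewrite (connect_trans s_ks' ks'k) (connect_trans s'_ks s'1).
move=> s; have [t pt st] := connect_preserves_sides s.
by case/orP: (sorted t pt) => /andP[/(connect_trans st)-> _]; rewrite ?orbT.
Qed.

End TwoComponents.

(** * The upper bound *)

Lemma min_degree_le (V : finType) (G : sgraph V) v : min_degree G <= degree G v.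
Proof.
rewrite /min_degree; have := mem_index_enum v.
elim: (index_enum V) => // w vs IH; rewrite big_cons inE geq_min.
by case/orP=> [/eqP->|/IH->]; rewrite ?leqnn ?orbT.
Qed.

Lemma le_min_degree (V : finType) (G : sgraph V) d :
  d <= #|V| -> (forall v, d <= degree G v) -> d <= min_degree G.
Proof.
by move=> dV dG; rewrite /min_degree; elim/big_rec: _ => // v m _ dm; rewrite leq_min dG.
Qed.

Section Balanced.
Variable r : nat.
Notation V := ('I_r + 'I_r)%type.
Notation left := (@Defs.is_left r).

Lemma card_left : #|[set v | left v]| = r.
Proof.
have -> : [set v | left v] = [set inl i | i : 'I_r].
  apply/setP => -[i|i]; rewrite !inE; apply/esym; last by apply/imsetP => -[].
  by apply/imsetP; exists i.
by rewrite card_imset ?card_ord // => i j [].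
Qed.

Lemma card_right : #|[set v | ~~ left v]| = r.
Proof.
have := cardsC [set v | left v]; rewrite card_left card_sum card_ord.
have -> : ~: [set v | left v] = [set v | ~~ left v] by apply/setP => v; rewrite !inE.
by move/addnI.
Qed.

Lemma card_nonneighbours (X : sgraph V) d v : edge_subgraph X (Krr r) ->
  d <= degree X v -> #|[set w | (left w != left v) && ~~ X v w]| <= r - d.
Proof.
move=> XK dv; pose O := [set w | left w != left v].
have cardO : #|O| = r.
  rewrite /O; case: (left v); [rewrite -[RHS]card_right|rewrite -[RHS]card_left];
    by apply: eq_card => w; rewrite !inE; case: (left w).
have := cardsID [set w | X v w] O; rewrite cardO.
have -> : O :&: [set w | X v w] = [set w | X v w].
  apply/setIidPr/subsetP => w; rewrite !inE => /XK.
  by rewrite /= /Krr_adj eq_sym.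
have -> : O :\: [set w | X v w] = [set w | (left w != left v) && ~~ X v w].
  by apply/setP => w; rewrite !inE andbC.
by move=> E; rewrite -[Z in _ <= Z - d]E (leq_trans _ (leq_sub2l _ dv)) // addKn.
Qed.

(** By symmetry [a] is a left place.  If a right person stands on it, the two
    sides of the people change names. *)
Lemma exchangeable_Krr (X Y : sgraph V) (d : nat) : 2 <= r -> 3 * r + 2 <= 4 * d ->
  edge_subgraph X (Krr r) -> edge_subgraph Y (Krr r) ->
  (forall v, d <= degree X v) -> (forall v, d <= degree Y v) ->
  forall (s : {perm V}) a b, X a b -> Krr r (s a) (s b) -> exchangeable X Y s a b.
Proof.
move=> r2 rd XK YK dX dY s a b.
wlog la : a b / left a => [WL|] Xab Kab.
  case la: (left a); first exact: WL.
  rewrite /exchangeable tpermC; apply: WL; rewrite 1?edge_sym //.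
  by move: (XK _ _ Xab); rewrite /= /Krr_adj la; case: (left b).
have lb : ~~ left b by move: (XK _ _ Xab); rewrite /= /Krr_adj la; case: (left b).
have dense : 4 * (r - d) + 2 <= r by lia.
have mX v := card_nonneighbours XK (dX v); have mY v := card_nonneighbours YK (dY v).
move: Kab; rewrite /= /Krr_adj; case lsa: (left (s a)) => lsb.
  by apply: (exchangeable_of_dense card_left card_right card_left
    mX mY dense); rewrite ?lsa //; case: (left (s b)) lsb.
apply: (@exchangeable_of_dense _ X Y left (fun v => ~~ left v) r (r - d)) => //.
- exact: card_left.
- exact: card_right.
- exact: card_right.
- move=> v; apply: leq_trans (mY v); apply/subset_leq_card/subsetP => w.
  by rewrite !inE; case: (left w); case: (left v).
by rewrite lsa.
Qed.

(** [Y] and then [X] are replaced by the complete bipartite graph. *)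
Lemma forces_two_components_dense d :
  2 <= r -> 3 * r + 2 <= 4 * d -> forces_two_components r d.
Proof.
move=> r2 rd X Y XK YK dX dY; rewrite -(num_components_Krr r2).
have degX v := leq_trans dX (min_degree_le X v).
have degY v := leq_trans dY (min_degree_le Y v).
have KK : edge_subgraph (Krr r) (Krr r) by [].
have degK v : d <= degree (Krr r) v.
  by apply: leq_trans (degX v) _; apply/subset_leq_card/subsetP => w; rewrite !inE => /XK.
apply: eq_n_comp => s t.
rewrite (connect_FS_closure YK (exchangeable_Krr r2 rd XK YK degX degY)).
have flip (G H : sgraph V) s' t' :
    connect (FS G H) s' t' = connect (FS H G) s'^-1%g t'^-1%g.
  by apply/idP/idP => /connect_FS_inv; rewrite ?invgK.
rewrite flip (connect_FS_closure XK (exchangeable_Krr r2 rd KK XK degK degX)).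
by rewrite -flip.
Qed.

End Balanced.

(** * The lower bound *)

(** [k |-> c + k] permutes the residues modulo [n]. *)
Lemma sum_residues n c h : h <= n -> \sum_(k < n) ((c + k) %% n < h) = h.
Proof.
case: n => [|n] hn; first by rewrite big_ord0; move: hn; case: h.
pose f (k : 'I_n.+1) : 'I_n.+1 := inord ((c + k) %% n.+1).
have fE k : f k = (c + k) %% n.+1 :> nat by rewrite inordK // ltn_mod.
have f_inj : injective f.
  move=> x y /(congr1 val) /=; rewrite !fE => /eqP; rewrite eqn_modDl.
  by rewrite !modn_small // => /eqP/val_inj.
rewrite (eq_bigr (fun k => nat_of_bool (f k < h))); last by move=> k _; rewrite fE.
rewrite -(@reindex_inj _ _ _ _ f xpredT (fun k => nat_of_bool (k < h)) f_inj) /=.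
rewrite -(big_mkord xpredT (fun k => nat_of_bool (k < h))).
rewrite (big_cat_nat (leq0n h) hn) /= big_nat_cond (eq_bigr (fun=> 1)).
  rewrite -big_nat_cond sum_nat_const_nat muln1 subn0 big_nat_cond big1 ?addn0 //.
  by move=> k /andP[/andP[hk _] _]; rewrite ltnNge hk.
by move=> k /andP[/andP[_ ->]].
Qed.

Lemma count_block n c lo h (b : bool) : h <= n ->
  \sum_(lo <= k < lo + n) (((c + k) %% n < h) == b) = if b then h else n - h.
Proof.
move=> hn; rewrite -{1}(add0n lo) big_addn addKn big_mkord.
have E := sum_residues (c + lo) hn.
under eq_bigr => k _ do rewrite (addnC k) addnA.
case: b; first by rewrite -[RHS]E; apply: eq_bigr => k _; rewrite eqb_id.
apply/eqP; rewrite -(eqn_add2r h) subnK // -[X in _ + X == _]E -big_split /=.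
rewrite (eq_bigr (fun=> 1)) ?sum1_card ?card_ord // => k _.
by case: (_ < h).
Qed.

Section IsolatedVertex.
Variable r : nat.
Notation V := ('I_r + 'I_r)%type.
Notation left := (@Defs.is_left r).

Definition label (v : V) : nat := match v with inl i => i | inr i => i end.

Definition low (v : V) := label v < r./2.

(** A regular bipartite graph of about half the possible degree on the low
    labels, and one on the high labels; modulo the size of the block, the sum of
    two labels decides adjacency. *)
Definition half_block i j :=
  if i < r./2 then (i + j) %% r./2 < r./2./2
  else (i + j) %% (r - r./2) < (r - r./2)./2.

(** The graphs for [b = true] and [b = false] share the edges between a low and a
    high label, and split the other edges of the complete bipartite graph. *)
Definition half_adj (b : bool) (v w : V) :=
  Krr_adj v w && ((low v != low w) || (half_block (label v) (label w) == b)).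

Lemma half_adj_sym b : symmetric (half_adj b).
Proof.
move=> v w; rewrite /half_adj -[Krr_adj v w]/(Krr r v w) edge_sym; congr (_ && _).
rewrite eq_sym; have [//|/negbNE/eqP vw /=] := boolP (low w != low v).
rewrite /half_block -/(low v) -/(low w) vw.
by rewrite addnC.
Qed.

Lemma half_adj_irr b : irreflexive (half_adj b).
Proof. by move=> v; rewrite /half_adj -[Krr_adj v v]/(Krr r v v) edge_irr. Qed.

Definition half_graph b : sgraph V := SGraph (half_adj_sym b) (half_adj_irr b).

Lemma half_graph_sub b : edge_subgraph (half_graph b) (Krr r).
Proof. by move=> v w /andP[]. Qed.

Lemma half_graph_degree b v : 3 * r %/ 4 <= degree (half_graph b) v.
Proof.
have -> : degree (half_graph b) v = \sum_(0 <= j < r)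
    (((label v < r./2) != (j < r./2)) || (half_block (label v) j == b)).
  rewrite /degree -sum1dep_card big_mkcond big_sumType big_mkord /=.
  case: v => i /=; [rewrite big1 // add0n|rewrite addnC big1 // add0n];
    by apply: eq_bigr => j _; rewrite inE /half_adj /=; case: (_ || _).
have p_le : r./2 <= r by lia.
rewrite (big_cat_nat (leq0n _) p_le) /=.
have [lo|hi] := ltnP (label v) r./2.
  rewrite [X in _ <= _ + X](eq_big_nat _ _ (F2 := fun=> 1)); last first.
    by move=> j /andP[pj _]; rewrite ltnNge pj.
  rewrite (eq_big_nat _ _ (F2 := fun j =>
    nat_of_bool (((label v + j) %% r./2 < r./2./2) == b))); last first.
    by move=> j /andP[_ jp]; rewrite jp /half_block lo.
  have := @count_block r./2 (label v) 0 r./2./2 b; rewrite add0n => -> //; last by lia.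
  by rewrite sum_nat_const_nat muln1; case: b; lia.
rewrite (eq_big_nat _ _ (F2 := fun=> 1)); last first.
  by move=> j /andP[_ jp]; rewrite jp.
rewrite [X in _ <= _ + X](eq_big_nat _ _ (F2 := fun j =>
  nat_of_bool (((label v + j) %% (r - r./2) < (r - r./2)./2) == b))); last first.
  by move=> j /andP[pj _]; rewrite ltnNge pj /half_block ltnNge hi.
have := @count_block (r - r./2) (label v) r./2 (r - r./2)./2 b.
rewrite subnKC // => -> //; last by lia.
by rewrite sum_nat_const_nat muln1; case: b; lia.
Qed.

Definition flip_high (v : V) : V :=
  if low v then v else match v with inl i => inr i | inr i => inl i end.

Lemma flip_highK : involutive flip_high.
Proof.
by case=> i; rewrite /flip_high /low /=;
  have [lo|/negbTE hi] := boolP (i < r./2); rewrite /= ?lo ?hi.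
Qed.

(** The people with high labels stand on the wrong side.  Opposite places with
    a low and a high label are thus held by people of one side.  Otherwise the two
    people have the labels of their places, and these labels are joined in only
    one of the two graphs. *)
Definition isolated_arrangement : {perm V} := perm (inv_inj flip_highK).

Lemma isolated_arrangementP t :
  ~~ FS (half_graph true) (half_graph false) isolated_arrangement t.
Proof.
apply/negP => /fs_adjP[v [w []]] /=; rewrite !permE => /andP[vw H] /andP[vw' H'] _.
have idx u : label (flip_high u) = label u by rewrite /flip_high; case: ifP; case: u.
move: H H'; rewrite /low !idx -/(low v) -/(low w).
have -> : low v = low w.
  move: vw vw'; rewrite /Krr_adj /flip_high.
  by case: (low v); case: (low w); case: v => ?; case: w => ?.
by rewrite eqxx /= => /eqP->.
Qed.

(** The three components are those of the isolated arrangement, of one of the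
    other parity, and of one of the same parity obtained by two transpositions. *)
Lemma not_forces_two_components d : 2 <= r -> d <= 3 * r %/ 4 ->
  ~ forces_two_components r d.
Proof.
move=> r2 dr /(_ _ _ (@half_graph_sub true) (@half_graph_sub false)).
have dV : d <= #|{: V}| by rewrite card_sum card_ord; lia.
have min_b b : d <= min_degree (half_graph b).
  by apply: le_min_degree => // v; apply: leq_trans dr (half_graph_degree b v).
move=> /(_ (min_b true) (min_b false)) two.
have r0 : 0 < r by apply: ltnW.
pose a : V := inl (Ordinal r0); pose a' : V := inl (Ordinal r2).
pose b : V := inr (Ordinal r0); pose b' : V := inr (Ordinal r2).
pose s0 := isolated_arrangement.
pose s1 := (tperm b b' * s0)%g; pose s2 := (tperm a a' * s1)%g.
set E := FS (half_graph true) (half_graph false) in two.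
have isolated t : connect E s0 t -> s0 = t.
  case/connectP => -[|u p] //= /andP[s0u _].
  by case/negP: (isolated_arrangementP u).
have: 2 < num_components E; last by rewrite two.
apply: (@n_comp_gt2 _ _ s0 s1 s2); first exact: FS_connect_sym.
- apply/negP => /isolated/permP/(_ b); rewrite permM tpermL.
  by move/perm_inj.
- apply/negP => /isolated/permP/(_ a); rewrite permM tpermL permM tpermD //.
  by move/perm_inj.
apply/negP => s12; suff: side_parity s1 = side_parity s2.
  by rewrite (@side_parity_same_side r a a' s1) //; case: (side_parity s1).
apply: side_parity_connect; apply: connect_sub s12 => {}s t /fs_adjP.
case=> x [y [/half_graph_sub Kxy /half_graph_sub Ksxy ->]].
exact: swap_connect.
Qed.

End IsolatedVertex.

(** * The threshold *)

Lemma d_rr_lower r : 2 <= r -> 3 * r + 1 <= 4 * d_rr r.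
Proof.
move=> r2; rewrite /d_rr; case: ex_minnP => d /asboolP forces_d _.
have [le|gt] := leqP d (3 * r %/ 4); last by lia.
by case: (not_forces_two_components r2 le).
Qed.

Lemma d_rr_upper r d : 2 <= r -> 3 * r + 2 <= 4 * d -> d_rr r <= d.
Proof.
move=> r2 rd; rewrite /d_rr; case: ex_minnP => e _; apply; apply/asboolP.
exact: forces_two_components_dense.
Qed.

Import Order.TTheory GRing.Theory Num.Theory.
Local Open Scope ring_scope.

Theorem theorem1p4 (r : nat) (hr : (2 <= r)%N) :
  Num.ceil ((3 * r + 1)%:R / 4 : rat) <= (d_rr r)%:Z <=
    Num.ceil ((3 * r + 2)%:R / 4 : rat).
Proof.
have ceil_quarter (k d : nat) :
    (Num.ceil (k%:R / 4 : rat) <= d%:Z) = (k <= 4 * d)%N.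
  by rewrite ceil_le_int ler_pdivrMr // -natrM ler_nat mulnC.
apply/andP; split; first by rewrite ceil_quarter d_rr_lower.
set c := Num.ceil _; have c_ge0 : 0 <= c.
  by rewrite ceil_ge0 (lt_le_trans (ltrN10 _)) // divr_ge0 ?ler0n.
rewrite -(gez0_abs c_ge0) lez_nat; apply: d_rr_upper => //.
by rewrite -ceil_quarter gez0_abs.
Qed.
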